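(* There exist an integer $r$ and an infinite family of DAGs $G$ with maximum in-degree $\Delta_{in}=2$ and maximum out-degree $\Delta_{out}=3$ (with $r\ge \Delta_{in}+1$), having unboundedly many nodes, such that with fast memory capacity $r$ we have $\mathrm{OPT}_{RBP}(G,r)=\Theta(n)$, where $n$ is the number of nodes of $G$, but $\mathrm{OPT}_{PRBP}(G,r)=2$.
   Context: All DAGs $G=(V,E)$ are finite and have no isolated nodes. Sources are nodes of in-degree 0, sinks are nodes of out-degree 0. An integer $r\ge 1$ (fast memory capacity) is given. Red-blue pebble game (RBP, one-shot). Initially exactly the sources carry blue pebbles and there are no other pebbles. Moves: (1) Save: place a blue pebble on any node that has a red pebble. (2) Load: place a red pebble on any node that has a blue pebble. (3) Compute: if all in-neighbors of a non-source node $v$ have red pebbles, place a red pebble on $v$; this may be applied at most once per node $v$ (one-shot). (4) Delete: remove a red pebble from any node. At every time at most $r$ nodes carry red pebbles. A pebbling is a sequence of moves after which every sink has a blue pebble. Partial-computing red-blue pebble game (PRBP, one-shot). There are blue, light red and dark red pebbles, and edges can be marked. Initially exactly the sources carry blue pebbles, there are no other pebbles, and all edges are unmarked. Moves: (1) Save: replace a dark red pebble on a node by a blue and a light red pebble. (2) Load: place a light red pebble on a node that has a blue pebble. (3) Partial compute: for an unmarked edge $(u,v)$ such that (i) all incoming edges of $u$ are marked, (ii) $u$ has a (light or dark) red pebble, and (iii) $v$ has a (light or dark) red pebble or no pebble at all, replace all pebbles on $v$ by one dark red pebble and mark $(u,v)$ (each edge is marked at most once and never unmarked). (4) Delete: remove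 a light red pebble from any node, or remove a dark red pebble from a non-sink node all of whose outgoing edges are marked. At every time the total number of (light and dark) red pebbles is at most $r$. A pebbling is a sequence of moves after which every sink has a blue pebble and every edge is marked. In both games the cost of a pebbling is the total number of save and load moves. $\mathrm{OPT}_{RBP}(G,r)$ and $\mathrm{OPT}_{PRBP}(G,r)$ denote the minimum cost of a pebbling of $G$ with capacity $r$ in RBP and PRBP, respectively. *)

(* Defs.v *)
From mathcomp Require Import all_boot all_order all_algebra.
Set Implicit Arguments.
Unset Strict Implicit.
Unset Printing Implicit Defensive.
Import Order.TTheory GRing.Theory Num.Theory.

Record dag := Dag {
  node :> finType;
  edge : rel node;
  (* [cycle edge c] holds for every closed walk, self-loops included. *)
  dag_acyclic : forall c : seq node, cycle edge c -> c = [::];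
  dag_no_isolated : forall v : node, exists w : node, edge v w || edge w v
}.

Section Graph.
Variable G : dag.
Implicit Types u v : G.

Definition in_nbrs v : {set G} := [set u | edge u v].
Definition out_nbrs v : {set G} := [set w | edge v w].
Definition is_source v : bool := #|in_nbrs v| == 0.
Definition is_sink v : bool := #|out_nbrs v| == 0.
Definition num_nodes : nat := #|node G|.
Definition max_indegree : nat := \max_(v : G) #|in_nbrs v|.
Definition max_outdegree : nat := \max_(v : G) #|out_nbrs v|.

End Graph.

Section Play.
Variables (S M : Type) (step : S -> M -> option S).

Fixpoint play (s : S) (ms : seq M) : option S :=
  if ms is m :: ms' then
    if step s m is Some s' then play s' ms' else None
  else Some s.

End Play.

(* [min_cost P cost k]: the minimum of [cost] over the move sequences
   satisfying [P] exists and equals [k]. *)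
Definition min_cost (M : Type) (P : pred (seq M)) (cost : seq M -> nat)
    (k : nat) : Prop :=
  (exists2 ms, P ms & cost ms = k) /\ (forall ms, P ms -> k <= cost ms).

Section RBP.
Variables (G : dag) (r : nat).

(* [rbp_computed] records the nodes already computed (one-shot rule). *)
Record rbp_state := RbpState {
  rbp_blue : {set G};
  rbp_red : {set G};
  rbp_computed : {set G}
}.

Inductive rbp_move :=
  | RSave of G
  | RLoad of G
  | RCompute of G
  | RDelete of G.

Definition rbp_legal (s : rbp_state) (m : rbp_move) : bool :=
  match m with
  | RSave v => v \in rbp_red s
  | RLoad v => v \in rbp_blue s
  | RCompute v => [&& ~~ is_source v, in_nbrs v \subset rbp_red s
                    & v \notin rbp_computed s]
  | RDelete v => v \in rbp_red s
  end.

Definition rbp_next (s : rbp_state) (m : rbp_move) : rbp_state :=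
  let: RbpState B R C := s in
  match m with
  | RSave v => RbpState (v |: B) R C
  | RLoad v => RbpState B (v |: R) C
  | RCompute v => RbpState B (v |: R) (v |: C)
  | RDelete v => RbpState B (R :\ v) C
  end.

Definition rbp_step (s : rbp_state) (m : rbp_move) : option rbp_state :=
  let s' := rbp_next s m in
  if rbp_legal s m && (#|rbp_red s'| <= r) then Some s' else None.

Definition rbp_init : rbp_state :=
  RbpState [set v : G | is_source v] set0 set0.

Definition rbp_final (s : rbp_state) : bool :=
  [forall v : G, is_sink v ==> (v \in rbp_blue s)].

Definition rbp_pebbling (ms : seq rbp_move) : bool :=
  if play rbp_step rbp_init ms is Some s then rbp_final s else false.

Definition rbp_io (m : rbp_move) : bool :=
  match m with RSave _ | RLoad _ => true | _ => false end.

Definition rbp_cost (ms : seq rbp_move) : nat := count rbp_io ms.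

Definition is_OPT_RBP (k : nat) : Prop := min_cost rbp_pebbling rbp_cost k.

End RBP.

Section PRBP.
Variables (G : dag) (r : nat).

Record prbp_state := PrbpState {
  prbp_blue : {set G};
  prbp_light : {set G};
  prbp_dark : {set G};
  prbp_marked : {set G * G}
}.

Inductive prbp_move :=
  | PSave of G
  | PLoad of G
  | PCompute of G & G
  | PDeleteLight of G
  | PDeleteDark of G.

Definition in_marked (s : prbp_state) (v : G) : bool :=
  [forall u : G, edge u v ==> ((u, v) \in prbp_marked s)].

Definition out_marked (s : prbp_state) (v : G) : bool :=
  [forall w : G, edge v w ==> ((v, w) \in prbp_marked s)].

Definition prbp_red (s : prbp_state) : {set G} :=
  prbp_light s :|: prbp_dark s.

Definition prbp_legal (s : prbp_state) (m : prbp_move) : bool :=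
  match m with
  | PSave v => v \in prbp_dark s
  | PLoad v => v \in prbp_blue s
  | PCompute u v =>
      [&& edge u v, (u, v) \notin prbp_marked s, in_marked s u,
          u \in prbp_red s
        & (v \in prbp_red s) || (v \notin prbp_blue s)]
  | PDeleteLight v => v \in prbp_light s
  | PDeleteDark v => [&& v \in prbp_dark s, ~~ is_sink v & out_marked s v]
  end.

Definition prbp_next (s : prbp_state) (m : prbp_move) : prbp_state :=
  let: PrbpState B L D E := s in
  match m with
  | PSave v => PrbpState (v |: B) (v |: L) (D :\ v) E
  | PLoad v => PrbpState B (v |: L) D E
  | PCompute u v => PrbpState (B :\ v) (L :\ v) (v |: D) ((u, v) |: E)
  | PDeleteLight v => PrbpState B (L :\ v) D E
  | PDeleteDark v => PrbpState B L (D :\ v) E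
  end.

Definition prbp_step (s : prbp_state) (m : prbp_move) : option prbp_state :=
  let s' := prbp_next s m in
  if prbp_legal s m && (#|prbp_light s'| + #|prbp_dark s'| <= r)
  then Some s' else None.

Definition prbp_init : prbp_state :=
  PrbpState [set v : G | is_source v] set0 set0 set0.

Definition prbp_final (s : prbp_state) : bool :=
  [forall v : G, is_sink v ==> (v \in prbp_blue s)] &&
  [forall u : G, forall v : G, edge u v ==> ((u, v) \in prbp_marked s)].

Definition prbp_pebbling (ms : seq prbp_move) : bool :=
  if play prbp_step prbp_init ms is Some s then prbp_final s else false.

Definition prbp_io (m : prbp_move) : bool :=
  match m with PSave _ | PLoad _ => true | _ => false end.

Definition prbp_cost (ms : seq prbp_move) : nat := count prbp_io ms.

Definition is_OPT_PRBP (k : nat) : Prop := min_cost prbp_pebbling prbp_cost k.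

End PRBP.

(* [f = Theta(n)] along a family indexed by [I], as [n i] tends to infinity. *)
Definition Theta (I : Type) (f n : I -> nat) : Prop :=
  exists a b : rat, [/\ (0 < a)%R, (0 < b)%R &
    exists N : nat, forall i : I, N <= n i ->
      (a * (n i)%:R <= (f i)%:R /\ (f i)%:R <= b * (n i)%:R)%R].

(* Main.v *)
Require Import Defs.
From mathcomp Require Import all_boot all_order all_algebra.
From mathcomp Require Import zify.
From Stdlib Require Import ClassicalEpsilon.
Set Implicit Arguments.
Unset Strict Implicit.
Unset Printing Implicit Defensive.

(** With capacity 3, chain "diamonds" u -> c, d, e; c, d -> b; b -> e, the exit e
    of each being the top u of the next.

    RBP: the top u is needed again for e, after b.  If no node among u, c, d, b
    is ever loaded, then at the moment b is computed the pebbles on u, c, d and b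
    are all still in use, one too many.  Hence every diamond costs a load, and
    saving and reloading u is enough.

    PRBP: b absorbs c, then c is deleted before d is computed and absorbed in
    turn, so three pebbles suffice and the only I/O is loading the source and
    saving the sink. *)

(** * Minimal costs and invariants of runs *)

(** Descent on the cost: excluded middle decides whether a cheaper sequence satisfying [P] exists,
    and if none does the current one is minimal. *)
Lemma ex_min_cost (M : Type) (P : pred (seq M)) (cost : seq M -> nat) ms :
  P ms -> exists k, min_cost P cost k.
Proof.
have [n] := ubnP (cost ms); elim: n ms => // n IHn ms /ltnSE le_n Pms.
have [[ms' [Pms' lt_ms']]|min_ms] := classic (exists ms', P ms' /\ cost ms' < cost ms).
  exact: IHn (leq_trans lt_ms' le_n) Pms'.
exists (cost ms); split=> [|ms' Pms']; first by exists ms.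
by rewrite leqNgt; apply/negP => lt_ms'; apply: min_ms; exists ms'.
Qed.

Section PlayTheory.
Variables (S M : Type) (step : S -> M -> option S).

Lemma play_cat s ms1 ms2 s' : play step s ms1 = Some s' ->
  play step s (ms1 ++ ms2) = play step s' ms2.
Proof.
by elim: ms1 s => [|m ms1 IH] s /= => [[->]|] //; case: step => // s1; apply: IH.
Qed.

(** Meant for contrapositive use: [ok] rules out certain moves, and an invariant of all the others
    shows that a successful run needs a ruled-out move. *)
Lemma play_invariant (I : S -> Prop) (ok : pred M) :
    (forall s m s', I s -> ok m -> step s m = Some s' -> I s') ->
  forall ms s s', I s -> all ok ms -> play step s ms = Some s' -> I s'.
Proof.
move=> I_step; elim=> [|m ms IH] s s' Is /=; first by move=> _ [<-].
case/andP=> ok_m ok_ms; case step_m: step => [s1|//].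
by apply: IH => //; apply: I_step step_m.
Qed.

End PlayTheory.

(** * Bounds valid for every graph *)

Section GeneralBounds.
Variable G : dag.

Lemma source_no_in (v w : G) : is_source v -> edge w v = false.
Proof. by rewrite /is_source cards_eq0 => /eqP/setP/(_ w); rewrite !inE. Qed.

Lemma sink_no_out (v w : G) : is_sink v -> edge v w = false.
Proof. by rewrite /is_sink cards_eq0 => /eqP/setP/(_ w); rewrite !inE. Qed.

Lemma in_nbrs_nonsource (u v : G) : edge u v -> is_source v = false.
Proof. by move=> uv; apply: contraTF uv => /source_no_in ->. Qed.

Lemma source_nonsink (v : G) : is_source v -> is_sink v = false.
Proof.
move=> src; apply: contraTF src => snk; have [w] := dag_no_isolated v.
by rewrite sink_no_out // => /in_nbrs_nonsource ->.
Qed.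

Definition rbp_load_node (m : rbp_move G) := if m is RLoad v then Some v else None.

Lemma rbp_cost_loads (ms : seq (rbp_move G)) :
  size (pmap rbp_load_node ms) <= rbp_cost ms.
Proof. by rewrite size_pmap; apply: sub_count => -[]. Qed.

(** The second conjunct carries computedness backwards along edges, from the sink towards the
    source. *)
Definition rbp_closed (s : rbp_state G) :=
  (forall v, v \in rbp_blue s :|: rbp_red s -> is_source v || (v \in rbp_computed s))
  /\ (forall u v, edge u v -> v \in rbp_computed s ->
        is_source u || (u \in rbp_computed s)).

Lemma rbp_play_closed r ms s :
  play (rbp_step r) (rbp_init G) ms = Some s -> rbp_closed s.
Proof.
apply: (@play_invariant _ _ _ rbp_closed predT); last exact: all_predT.
  move=> [B R C] m s' [closedBR closedC] _; rewrite /rbp_step.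
  case: ifP => // /andP[legal _] [<-] {s'}.
  case: m legal => v /= legal; split=> //= x.
  - by rewrite !inE => /orP[/predU1P[->|in_x]|in_x]; apply: closedBR; rewrite inE ?legal ?in_x ?orbT.
  - by rewrite !inE => /orP[in_x|/predU1P[->|in_x]]; apply: closedBR; rewrite inE ?legal ?in_x ?orbT.
  - rewrite !inE orbCA => /predU1P[->|in_x]; first by rewrite eqxx orbT.
    by rewrite orbCA closedBR ?orbT // inE.
  - move=> y xy; rewrite !inE => /predU1P[y_v|in_y]; last by rewrite orbCA (closedC x y) ?orbT.
    case/and3P: legal => _ /subsetP/(_ x) + _; rewrite inE -y_v => /(_ xy) in_x.
    by rewrite orbCA closedBR ?orbT // inE in_x orbT.
  - by rewrite !inE => in_x; apply: closedBR; move: in_x; rewrite inE; case: eqP => //= _; rewrite orbF => ->.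
by split=> [v|u v _] /=; rewrite !inE // orbF => ->.
Qed.

(** A compute move only pebbles the head of an edge, so an unloaded source never turns red and its
    outgoing edges, at least one of them, stay unmarked. *)
Lemma prbp_load_source r ms v : is_source v -> prbp_pebbling (G := G) r ms ->
  has (fun m => if m is PLoad w then w == v else false) ms.
Proof.
move=> src; rewrite /prbp_pebbling; case run: play => [s|//] /andP[_ marked].
apply: contraT; rewrite -all_predC => no_load.
pose I (s : prbp_state G) := v \notin prbp_red s /\ forall w, (v, w) \notin prbp_marked s.
have [_ unmarked] : I s; last first.
  have [w] := dag_no_isolated v; rewrite [edge w v]source_no_in // orbF => vw.
  by move/forallP/(_ v)/forallP/(_ w): marked; rewrite vw (negPf (unmarked w)).
apply: play_invariant no_load run; last by split=> [|w]; rewrite !inE.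
move=> [B L D E] m s' [/= + unmarked] ok_m; rewrite !inE negb_or => /andP[vL vD].
rewrite /prbp_step; case: ifP => // /andP[legal _] [<-] {s'}.
case: m legal ok_m => [x|x|x y|x|x] /= legal ok_m; split=> //=; rewrite ?inE ?negb_or ?(negPf vL) ?(negPf vD) ?andbF ?orbF ?andbT //.
- by apply: contraNN vD => /eqP->.
- by rewrite eq_sym.
- by case/and5P: legal => xy _ _ _ _; apply: contraTneq xy => <-; rewrite source_no_in.
move=> w; rewrite !inE (negPf (unmarked w)) orbF.
case/and5P: legal => _ _ _ x_red _; apply: contraTneq x_red => -[<- _].
by rewrite inE (negPf vL).
Qed.

(** A sink is not isolated, hence not a source, so it starts without a blue pebble and only a save
    can provide one. *)
Lemma prbp_save_sink r ms v : is_sink v -> prbp_pebbling (G := G) r ms ->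
  has (fun m => if m is PSave w then w == v else false) ms.
Proof.
move=> snk; rewrite /prbp_pebbling; case run: play => [s|//] /andP[blue _].
apply: contraT; rewrite -all_predC => no_save.
suff unblue : v \notin prbp_blue s.
  by move/forallP/(_ v): blue; rewrite snk (negPf unblue).
apply: (play_invariant (I := fun s => v \notin prbp_blue s)) no_save run.
  move=> [B L D E] m s' /= vB ok_m.
  rewrite /prbp_step; case: ifP => // /andP[legal _] [<-] {s'}.
  case: m legal ok_m => [x|x|x y|x|x] //= legal ok_m; rewrite !inE (negPf vB) ?andbF //.
  by rewrite orbF eq_sym.
by rewrite inE; apply: contraTN snk => /source_nonsink ->.
Qed.

(** The load of the source and the save of the sink are of different kinds, hence two separate
    moves. *)
Lemma prbp_cost_ge2 r (ms : seq (prbp_move G)) (v w : G) : is_source v -> is_sink w ->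
  prbp_pebbling r ms -> 2 <= prbp_cost ms.
Proof.
move=> src snk peb.
have /= := prbp_load_source src peb; have /= := prbp_save_sink snk peb; rewrite !has_count.
rewrite /prbp_cost; elim: ms {peb} => //= -[x|x|x y|x|x] ms IH; rewrite ?add0n ?add1n ?ltnS //.
  by move=> _ /leq_trans; apply; apply: sub_count => -[].
by move=> /leq_trans le_save _; apply: le_save; apply: sub_count => -[].
Qed.

End GeneralBounds.

(** * A load forced by each diamond in RBP *)

Section Diamond.
Variables (G : dag) (u c d b e : G).

(** The in-neighbours of [u] and the out-neighbours of [e] are left free: these two nodes are shared
    with the adjacent diamonds. *)
Record diamond : Prop := Diamond {
  diamond_uniq : uniq [:: u; c; d; b; e];
  diamond_in_c : in_nbrs c = [set u];
  diamond_in_d : in_nbrs d = [set u];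
  diamond_in_b : in_nbrs b = [set c; d];
  diamond_in_e : in_nbrs e = [set u; b];
  diamond_out_u : out_nbrs u = [set c; d; e];
  diamond_out_c : out_nbrs c = [set b];
  diamond_out_d : out_nbrs d = [set b];
  diamond_out_b : out_nbrs b = [set e]
}.

Hypothesis dia : diamond.

(* Without loads, [c], [d] and [b] are red from their computation until their
   last use, so computing [b] with [u] still red takes four pebbles; and once
   [u] has lost its pebble, [e] cannot be computed any more. *)
Definition rbp_stuck (s : rbp_state G) :=
  [/\ forall x, x \in [:: u; c; d; b] -> x \in rbp_red s -> x \in rbp_computed s,
      c \in rbp_computed s -> u \in rbp_computed s,
      b \in rbp_computed s -> (u \in rbp_computed s) && (u \notin rbp_red s)
    & e \notin rbp_computed s].

(** A run loading none of the four nodes preserves [rbp_stuck]. Loads of [e] are allowed, since [e]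
    is counted with the next diamond. *)
Lemma rbp_diamond_load ms s :
    play (rbp_step 3) (rbp_init G) ms = Some s -> e \in rbp_computed s ->
  has (mem [:: u; c; d; b]) (pmap (@rbp_load_node G) ms).
Proof.
move=> run; apply: contraTT; rewrite -all_predC all_pmap => no_load.
have [] // : rbp_stuck s; apply: play_invariant no_load run; last first.
  by split; rewrite ?inE // => x _; rewrite inE.
case: dia => Hu in_c _ in_b in_e _ _ _ _.
move=> [B R C] m s' [/= redC cu bu eC] ok_m; rewrite /rbp_step.
case: ifP => // /andP[legal card] [<-] {s'}.
case: m legal card ok_m => v /= legal card ok_m.
- by split.
- split=> //= [x x_in|/bu/andP[-> uR]].
    by case/setU1P=> [x_v|]; [rewrite x_v (negPf ok_m) // in x_in | apply: redC].
  by rewrite in_setU1 negb_or uR andbT; apply: contraNneq ok_m => <-; rewrite mem_head.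
- case/and3P: legal => _ sub vC; split=> /=.
  + move=> x x_in; rewrite !in_setU1 => /predU1P[->|/redC->]; rewrite ?eqxx ?orbT //.
  + rewrite !in_setU1 => /predU1P[c_v|/cu ->]; rewrite ?orbT // redC ?orbT ?mem_head //.
    by apply: (subsetP sub); rewrite -c_v in_c inE.
  (* Computing [b] itself: a red [u] would give four red pebbles. If [b] was computed earlier, the
     one-shot rule keeps [u] from being recomputed. *)
  + rewrite !in_setU1 => /predU1P[b_v|/bu/andP[uC uR]].
      have cR : c \in R by apply: (subsetP sub); rewrite -b_v in_b !inE eqxx.
      have dR : d \in R by apply: (subsetP sub); rewrite -b_v in_b !inE eqxx orbT.
      rewrite cu ?orbT /=; last by apply: redC cR; rewrite !inE eqxx orbT.
      apply: contraTN card => u_red; rewrite -ltnNge.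
      have <- : #|[set:: [:: u; c; d; b]]| = 4.
        by rewrite cardsE; apply/card_uniqP; move: Hu; rewrite (cat_uniq [:: u; c; d; b] [:: e]) => /andP[].
      apply/subset_leq_card/subsetP => x; rewrite !inE => /or4P[]/eqP-> //.
      * by rewrite cR orbT.
      * by rewrite dR orbT.
      * by rewrite b_v eqxx.
    by rewrite uC orbT negb_or uR andbT /=; apply: contraNneq vC => <-.
  (* Computing [e] needs [u] and [b] red together, but a red [b] has been computed, which excludes a
     red [u]. *)
  + rewrite in_setU1 (negPf eC) orbF; apply/eqP => e_v.
    have uR : u \in R by apply: (subsetP sub); rewrite -e_v in_e !inE eqxx.
    have bR : b \in R by apply: (subsetP sub); rewrite -e_v in_e !inE eqxx orbT.
    by have /bu/andP[_ /negP] : b \in C by apply: redC bR; rewrite !inE eqxx !orbT.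
- split=> //= [x x_in|/bu/andP[-> uR]]; first by rewrite in_setD1 => /andP[_]; apply: redC.
  by rewrite in_setD1 (negPf uR) andbF.
Qed.

End Diamond.

(** * Executing moves on explicitly listed pebbles *)

(* A named constant, so that the pebbles on an explicit list of nodes can be matched
   syntactically when a strategy is executed. *)
Definition seqset (T : finType) (xs : seq T) : {set T} := [set x in xs].

Lemma in_seqset (T : finType) (xs : seq T) x : (x \in seqset xs) = (x \in xs).
Proof. by rewrite inE. Qed.

Lemma seqset_cons (T : finType) (xs : seq T) x : seqset (x :: xs) = x |: seqset xs.
Proof. by apply/setP=> y; rewrite !inE. Qed.

Lemma card_seqset (T : finType) (xs : seq T) : #|seqset xs| <= size xs.
Proof. by rewrite cardsE card_size. Qed.

Lemma seqsetD1 (T : finType) (xs : seq T) x :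
  seqset xs :\ x = seqset (filter (predC1 x) xs).
Proof. by apply/setP=> y; rewrite !inE mem_filter. Qed.

Lemma seqset0 (T : finType) : seqset [::] = set0 :> {set T}.
Proof. by apply/setP=> y; rewrite !inE. Qed.

Lemma seqset1 (T : finType) (x : T) : seqset [:: x] = [set x].
Proof. by apply/setP=> y; rewrite !inE. Qed.

Section RbpMoves.
Variables (G : dag) (r : nat) (B C : {set G}) (xs : seq G).
Local Notation play := (play (rbp_step (G := G) r)).
Local Notation s := (RbpState B (seqset xs) C).

(** Since the size of a list bounds the cardinality of its set, the capacity condition here and
    below is a computation on lists. *)
Lemma rbp_play_save v ms : v \in xs -> size xs <= r ->
  play s (RSave v :: ms) = play (RbpState (v |: B) (seqset xs) C) ms.
Proof.
by move=> vx le_r /=; rewrite /rbp_step /= inE vx (leq_trans (card_seqset _)).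
Qed.

Lemma rbp_play_load v ms : v \in B -> size xs < r ->
  play s (RLoad v :: ms) = play (RbpState B (seqset (v :: xs)) C) ms.
Proof.
by move=> vB le_r /=; rewrite /rbp_step /= vB -seqset_cons (leq_trans (card_seqset _)).
Qed.

Lemma rbp_play_compute v ms :
    0 < #|in_nbrs v| -> in_nbrs v \subset xs -> v \notin C -> size xs < r ->
  play s (RCompute v :: ms) = play (RbpState B (seqset (v :: xs)) (v |: C)) ms.
Proof.
move=> v_in sub vC le_r /=.
have -> : rbp_step r s (RCompute v) = Some (RbpState B (seqset (v :: xs)) (v |: C)).
  rewrite /rbp_step /= -seqset_cons (leq_trans (card_seqset _)) // /is_source -lt0n v_in vC.
  by rewrite !andbT ifT //; apply: subset_trans sub _; apply/subsetP => x; rewrite inE.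
by [].
Qed.

Lemma rbp_play_delete v ms : v \in xs -> size xs <= r ->
  play s (RDelete v :: ms) = play (RbpState B (seqset (filter (predC1 v) xs)) C) ms.
Proof.
move=> vx le_r /=; rewrite /rbp_step /= inE vx seqsetD1 (leq_trans (card_seqset _)) //.
by rewrite size_filter (leq_trans (count_size _ _)).
Qed.

End RbpMoves.

Section PrbpMoves.
Variables (G : dag) (r : nat) (B : {set G}) (ls ds : seq G) (E : {set G * G}).
Local Notation play := (play (prbp_step (G := G) r)).
Local Notation s := (PrbpState B (seqset ls) (seqset ds) E).

(** Restricted to targets with neither a blue nor a light pebble, so that the blue and light sets
    keep their form. *)
Lemma prbp_play_compute x y ms :
    x \in in_nbrs y -> (x, y) \notin E -> in_nbrs x \subset [set z | (z, x) \in E] ->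
    x \in ls ++ ds -> y \notin B -> y \notin ls ->
    size ls + (size (filter (predC1 y) ds)).+1 <= r ->
  play s (PCompute x y :: ms) =
  play (PrbpState B (seqset ls) (seqset (y :: filter (predC1 y) ds)) ((x, y) |: E)) ms.
Proof.
rewrite inE => xy xyE /subsetP in_x; rewrite mem_cat => x_red yB y_ls le_r /=; rewrite /prbp_step /=.
have -> : in_marked s x by apply/forallP=> z; apply/implyP; move: (in_x z); rewrite !inE.
rewrite xy xyE !inE x_red yB orbT seqsetD1.
have -> : [seq z <- ls | predC1 y z] = ls.
  by apply/all_filterP/allP => z z_ls /=; apply: contraNneq y_ls => <-.
have -> : B :\ y = B by apply/setDidPl; rewrite disjoint_sym disjoints1.
have -> : y |: seqset ds = seqset (y :: filter (predC1 y) ds).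
  by apply/setP=> z; rewrite !inE mem_filter /=; case: eqP.
by rewrite (leq_trans _ le_r) // leq_add // card_seqset.
Qed.

Lemma prbp_play_delete_dark x ms :
    x \in ds -> 0 < #|out_nbrs x| -> out_nbrs x \subset [set z | (x, z) \in E] ->
    size ls + size ds <= r ->
  play s (PDeleteDark x :: ms) =
  play (PrbpState B (seqset ls) (seqset (filter (predC1 x) ds)) E) ms.
Proof.
move=> x_ds x_out /subsetP out_x le_r /=; rewrite /prbp_step /=.
have -> : out_marked s x by apply/forallP=> z; apply/implyP; move: (out_x z); rewrite !inE.
rewrite inE x_ds /is_sink -lt0n x_out seqsetD1 /= (leq_trans _ le_r) //.
rewrite leq_add ?card_seqset // (leq_trans (card_seqset _)) //.
by rewrite size_filter count_size.
Qed.

Lemma prbp_play_delete_light x ms : x \in ls -> size ls + size ds <= r ->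
  play s (PDeleteLight x :: ms) =
  play (PrbpState B (seqset (filter (predC1 x) ls)) (seqset ds) E) ms.
Proof.
move=> x_ls le_r /=; rewrite /prbp_step /= inE x_ls seqsetD1 (leq_trans _ le_r) //.
rewrite leq_add ?card_seqset // (leq_trans (card_seqset _)) //.
by rewrite size_filter count_size.
Qed.

End PrbpMoves.

(** * Strategies on one diamond *)

Section DiamondPlay.
Variables (G : dag) (u c d b e : G).
Hypothesis dia : diamond u c d b e.
Local Arguments play : simpl never.

(** Both orientations of every inequality, packed into one rewrite rule that evaluates the filters
    and memberships of the strategies. *)
Lemma diamond_neqs :
  ((u == c = false) * (u == d = false) * (u == b = false) * (u == e = false) *
   (c == u = false) * (c == d = false) * (c == b = false) * (c == e = false) *
   (d == u = false) * (d == c = false) * (d == b = false) * (d == e = false) *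
   (b == u = false) * (b == c = false) * (b == d = false) * (b == e = false) *
   (e == u = false) * (e == c = false) * (e == d = false) * (e == b = false))%type.
Proof.
have /= := diamond_uniq dia; rewrite !inE !negb_or -!andbA.
do ![case/andP=> /negPf ?]; move=> _.
by do !split; rewrite // eq_sym.
Qed.

(** [u] is saved and dropped to make room for [b], then reloaded for [e] once [c] and [d] are gone:
    two I/O moves. *)
Definition rbp_diamond_moves : seq (rbp_move G) :=
  [:: RCompute c; RCompute d; RSave u; RDelete u; RCompute b; RDelete c;
      RDelete d; RLoad u; RCompute e; RDelete u; RDelete b].

Lemma rbp_diamond_play (B C : {set G}) :
    [/\ c \notin C, d \notin C, b \notin C & e \notin C] ->
  play (rbp_step 3) (RbpState B [set u] C) rbp_diamond_moves =
  Some (RbpState (u |: B) [set e] (C :|: seqset [:: c; d; b; e])).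
Proof.
case: dia => _ in_c in_d in_b in_e _ _ _ _ [cC dC bC eC].
have neq := diamond_neqs.
rewrite -seqset1 /rbp_diamond_moves rbp_play_compute ?in_c ?cards1 //; last by apply/subsetP=> x; rewrite !inE.
rewrite rbp_play_compute ?in_d ?cards1 //; first last.
- by rewrite !inE neq.
- by apply/subsetP=> x; rewrite !inE => /eqP->; rewrite eqxx orbT.
rewrite rbp_play_save ?inE ?eqxx ?orbT // rbp_play_delete ?inE ?eqxx ?orbT //=.
rewrite !neq eqxx /= rbp_play_compute ?in_b ?cards2 //; first last.
- by rewrite !inE !neq.
- by apply/subsetP=> x; rewrite !inE => /orP[]/eqP->; rewrite eqxx ?orbT.
rewrite rbp_play_delete ?inE ?eqxx ?orbT //= !neq eqxx /=.
rewrite rbp_play_delete ?inE ?eqxx ?orbT //= !neq eqxx /=.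
rewrite rbp_play_load ?inE ?eqxx //.
rewrite rbp_play_compute ?in_e ?cards2 //; first last.
- by rewrite !inE !neq.
- by apply/subsetP=> x; rewrite !inE => /orP[]/eqP->; rewrite eqxx ?orbT.
rewrite rbp_play_delete ?inE ?eqxx ?orbT //= !neq eqxx /=.
rewrite rbp_play_delete ?inE ?eqxx ?orbT //= !neq eqxx /=.
congr (Some (RbpState _ _ _)); apply/setP=> x; rewrite !inE //.
by case: (x == c); case: (x == d); case: (x == b); case: (x == e); rewrite ?orbT ?orbF.
Qed.

(** [del_u] is a parameter because the top of the first diamond is loaded, hence light, while later
    tops are computed, hence dark. *)
Definition prbp_diamond_moves (del_u : prbp_move G) : seq (prbp_move G) :=
  [:: PCompute u c; PCompute c b; PDeleteDark c; PCompute u d; PCompute d b;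
      PDeleteDark d; PCompute u e; del_u; PCompute b e; PDeleteDark b].

Definition diamond_edges : seq (G * G) :=
  [:: (u, c); (c, b); (u, d); (d, b); (u, e); (b, e)].

Lemma prbp_diamond_play (light : bool) (B : {set G}) (E : {set G * G}) :
    [/\ c \notin B, d \notin B, b \notin B & e \notin B] ->
    all (predC (mem E)) diamond_edges ->
    in_nbrs u \subset [set z | (z, u) \in E] ->
  play (prbp_step 3)
    (PrbpState B (if light then [set u] else set0)
                 (if light then set0 else [set u]) E)
    (prbp_diamond_moves (if light then PDeleteLight u else PDeleteDark u)) =
  Some (PrbpState B set0 [set e] (E :|: seqset diamond_edges)).
Proof.
case: dia => _ in_c in_d in_b in_e out_u out_c out_d out_b.
move=> [cB dB bB eB] + in_u => /=.
case/and5P=> /negPf ucE /negPf cbE /negPf udE /negPf dbE /and3P[/negPf ueE /negPf beE _].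
(* Three compute moves start from [u], each with more marked edges, so the condition on its incoming
   edges is made monotone. *)
have in_uS (E' : {set G * G}) : E \subset E' -> in_nbrs u \subset [set z | (z, u) \in E'].
  by move=> sE; apply: (subset_trans in_u); apply/subsetP=> z; rewrite !inE; apply: (subsetP sE).
have u_out : 0 < #|out_nbrs u| by rewrite out_u (cardsD1 c) !inE eqxx.
have neq := diamond_neqs.
pose rules := (in_c, in_d, in_b, in_e, out_u, out_c, out_d, out_b, subUset, sub1set,
  neq, xpair_eqE, ucE, cbE, udE, dbE, ueE, beE, eqxx).
rewrite -!seqset1 -!seqset0 -!(fun_if (@seqset G)).
have grow (E' : {set G * G}) p : E \subset E' -> E \subset p |: E'.
  by move/subset_trans; apply; apply: subsetUr.
rewrite /prbp_diamond_moves.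
case: light.
(* One round per move; [rules] decides the legality conditions of each. *)
all: do 10!(first [rewrite prbp_play_compute | rewrite prbp_play_delete_dark
                  | rewrite prbp_play_delete_light];
   rewrite /= ?neq ?eqxx //=;
   try by rewrite ?(rules, inE, orbT, cards1, cards2) ?in_uS ?grow).
all: congr (Some (PrbpState _ _ _ _)); apply/setP=> p; rewrite !inE.
all: case: (p == (u, c)); case: (p == (c, b)); case: (p == (u, d)).
all: case: (p == (d, b)); case: (p == (u, e)); case: (p == (b, e)).
all: by rewrite ?orbT ?orbF.
Qed.

End DiamondPlay.

(** * The chain of diamonds *)

(* Diamond [q] has top [4q], sides [4q+1] and [4q+2], bottom [4q+3], and its exit
   [4q+4] is the top of diamond [q+1]; the offsets are those of the out-neighbours. *)
Definition chain_offsets (x : nat) : seq nat :=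
  match x %% 4 with 0 => [:: 1; 2; 4] | 1 => [:: 2] | _ => [:: 1] end.

Definition chain_edge n : rel 'I_n :=
  fun x y => (y : nat) \in [seq x + j | j <- chain_offsets x].

(** The arithmetic form of adjacency that [lia] can decide. *)
Lemma chain_edgeE n (x y : 'I_n) : chain_edge x y =
  [|| (x %% 4 == 0) && [|| y == x + 1 :> nat, y == x + 2 :> nat | y == x + 4 :> nat],
      (x %% 4 == 1) && (y == x + 2 :> nat) | (1 < x %% 4) && (y == x + 1 :> nat)].
Proof.
rewrite /chain_edge /chain_offsets.
by case: (x %% 4) => [|[|k]] /=; rewrite !inE ?orbF.
Qed.

Lemma chain_edge_lt n (x y : 'I_n) : chain_edge x y -> x < y.
Proof. rewrite chain_edgeE; lia. Qed.

(** Edges increase the index, so a nonempty closed walk from [x] would give [x < x]. *)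
Lemma chain_acyclic n (c : seq 'I_n) : cycle (@chain_edge n) c -> c = [::].
Proof.
case: c => // x c /= path_c.
have : path (fun y z : 'I_n => y < z) x (rcons c x) by apply: sub_path path_c => y z /chain_edge_lt.
move/(order_path_min (fun _ _ _ => @ltn_trans _ _ _))/allP/(_ x).
by rewrite mem_rcons mem_head ltnn => /(_ isT).
Qed.

Lemma chain_no_isolated k (v : 'I_(4 * k.+1).+1) :
  exists w, chain_edge v w || chain_edge w v.
Proof.
have lt_v := ltn_ord v.
have [v_max|v_lt] := eqVneq (v : nat) (4 * k.+1).
  have lt_w : 4 * k + 3 < (4 * k.+1).+1 by lia.
  by exists (Ordinal lt_w); rewrite !chain_edgeE /=; lia.
(* Residue 1 is the side [c], whose only successor [b] lies two further; every other node but the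
   last has an edge to the next index. *)
have lt_w : v + (if v %% 4 == 1 then 2 else 1) < (4 * k.+1).+1 by case: ifP; lia.
exists (Ordinal lt_w); rewrite !chain_edgeE /=; case: ifP; lia.
Qed.

(** [k.+1] diamonds, so never none: four nodes for each, plus the final exit. *)
Definition chain (k : nat) : dag :=
  Dag (@chain_acyclic (4 * k.+1).+1) (@chain_no_isolated k).

Section Chain.
Variable k : nat.

(* Only meaningful for [x <= 4 * k.+1]; [inord] sends larger values to [0]. *)
Definition cnode (x : nat) : chain k := inord x.

Lemma cnodeK x : x <= 4 * k.+1 -> cnode x = x :> nat.
Proof. by move=> le_x; rewrite inordK. Qed.

Lemma cnode_ord (v : chain k) x : x = v :> nat -> v = cnode x.
Proof. by move=> ->; apply/esym/inord_val. Qed.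

Lemma cnode_eq (v : chain k) x : x <= 4 * k.+1 -> (v == cnode x) = (v == x :> nat).
Proof. by move=> le_x; rewrite -val_eqE /= cnodeK. Qed.

Lemma cedge (x y : chain k) : edge x y = chain_edge x y. Proof. by []. Qed.

Lemma chain_diamond q : q <= k ->
  diamond (cnode (4 * q)) (cnode (4 * q + 1)) (cnode (4 * q + 2))
          (cnode (4 * q + 3)) (cnode (4 * q + 4)).
Proof.
move=> le_q.
have lt_ord (z : chain k) : z < (4 * k.+1).+1 := ltn_ord z.
split; [| apply/setP=> z; have := lt_ord z; rewrite !inE !cedge chain_edgeE !cnode_eq ?cnodeK; lia ..].
by rewrite /= !inE !cnode_eq ?cnodeK; lia.
Qed.

Lemma chain_source (v : chain k) : is_source v = (v == 0 :> nat).
Proof.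
apply/idP/idP => [src|/eqP v0]; last first.
  by rewrite /is_source cards_eq0; apply/eqP/setP=> z; rewrite !inE cedge chain_edgeE; lia.
have lt_v : v < (4 * k.+1).+1 := ltn_ord v.
apply: contraT => v_pos.
(* A positive node has its preceding index as a predecessor, except the side [d], which is reached
   from the top two below. *)
have le_u : v - (if v %% 4 == 2 then 2 else 1) <= 4 * k.+1 by case: ifP; lia.
have := source_no_in (cnode (v - (if v %% 4 == 2 then 2 else 1))) src.
rewrite cedge chain_edgeE cnodeK //; case: ifP; lia.
Qed.

Lemma chain_sink (v : chain k) : is_sink v = (v == 4 * k.+1 :> nat).
Proof.
have lt_v : v < (4 * k.+1).+1 := ltn_ord v.
apply/idP/idP => [snk|/eqP v0]; last first.
  rewrite /is_sink cards_eq0; apply/eqP/setP=> z; rewrite !inE cedge chain_edgeE.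
  have lt_z : z < (4 * k.+1).+1 := ltn_ord z; lia.
apply: contraT => v_pos.
have le_u : v + (if v %% 4 == 1 then 2 else 1) <= 4 * k.+1 by case: ifP; lia.
have := sink_no_out (cnode (v + (if v %% 4 == 1 then 2 else 1))) snk.
rewrite cedge chain_edgeE cnodeK //; case: ifP; lia.
Qed.

Lemma chain_num_nodes : num_nodes (chain k) = (4 * k.+1).+1.
Proof. exact: card_ord. Qed.

Lemma chain_max_indegree : max_indegree (chain k) = 2.
Proof.
apply/eqP; rewrite eqn_leq; apply/andP; split.
  apply/bigmax_leqP=> v _; have lt_v : v < (4 * k.+1).+1 := ltn_ord v.
  (* All possible predecessors: an exit also has the top four below, other nodes at most the index
     two below. *)
  pose w1 := cnode (v - 1); pose w2 := cnode (if v %% 4 == 0 then v - 4 else v - 2).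
  apply: leq_trans (_ : #|[set w1; w2]| <= 2); last by rewrite cards2; case: eqP.
  apply/subset_leq_card/subsetP=> z; have lt_z : z < (4 * k.+1).+1 := ltn_ord z.
  rewrite !inE cedge chain_edgeE !cnode_eq; try case: ifP; lia.
have dia := chain_diamond (leq0n k).
apply: leq_trans (leq_bigmax (cnode (4 * 0 + 3))).
rewrite (diamond_in_b dia) cards2 cnode_eq ?cnodeK; lia.
Qed.

Lemma chain_max_outdegree : max_outdegree (chain k) = 3.
Proof.
apply/eqP; rewrite eqn_leq; apply/andP; split.
  apply/bigmax_leqP=> v _.
  (* Indices beyond the chain become node 0 here, which is harmless as only an inclusion is
     needed. *)
  apply: leq_trans (_ : #|seqset [:: cnode (v + 1); cnode (v + 2); cnode (v + 4)]| <= 3); last exact: card_seqset.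
  apply/subset_leq_card/subsetP=> z; rewrite in_seqset !inE cedge chain_edgeE => vz.
  have : v + 1 = z \/ v + 2 = z \/ v + 4 = z by lia.
  by case=> [|[]] /cnode_ord <-; rewrite eqxx ?orbT.
have dia := chain_diamond (leq0n k).
apply: leq_trans (leq_bigmax (cnode (4 * 0))).
rewrite (diamond_out_u dia).
have -> : [set cnode (4 * 0 + 1); cnode (4 * 0 + 2); cnode (4 * 0 + 4)]
   = [set x in [:: cnode (4 * 0 + 1); cnode (4 * 0 + 2); cnode (4 * 0 + 4)]].
  by apply/setP=> z; rewrite !inE orbA.
rewrite cardsE; apply/eq_leq/esym/card_uniqP.
by rewrite /= !inE !cnode_eq ?cnodeK; lia.
Qed.

End Chain.

(** * Costs on the chain *)

Section ChainCosts.
Variable k : nat.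
Local Notation cnode := (cnode k).

(** The blue sink must have been computed; the edge from the top of a diamond to its exit then
    passes computedness to the preceding exit. *)
Lemma chain_computed ms s : play (rbp_step 3) (rbp_init (chain k)) ms = Some s ->
  rbp_final s -> forall q, q <= k -> cnode (4 * q + 4) \in rbp_computed s.
Proof.
move=> /rbp_play_closed[closedBR closedC] /forallP final q le_q.
have nonsrc x : 0 < x <= 4 * k.+1 -> is_source (cnode x) = false.
  by move=> x_range; rewrite chain_source cnodeK; lia.
(* Induction on the distance to the last diamond. *)
have -> : q = k - (k - q) by lia.
elim: (k - q) (leq_subr q k) => [|j IH] le_j.
  have -> : 4 * (k - 0) + 4 = 4 * k.+1 by lia.
  have := closedBR (cnode (4 * k.+1)); rewrite nonsrc; last lia.
  by apply; rewrite inE (implyP (final _)) // chain_sink cnodeK.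
have le_k : k - j <= k by lia.
have := closedC (cnode (4 * (k - j))) (cnode (4 * (k - j) + 4)).
have -> : 4 * (k - j.+1) + 4 = 4 * (k - j) by lia.
rewrite nonsrc; last lia.
apply; last by apply: IH; lia.
have /setP/(_ (cnode (4 * (k - j)))) := diamond_in_e (chain_diamond le_k).
by rewrite !inE eqxx.
Qed.

(** Dividing a node by 4 gives its diamond. The forced loads hit every value from 0 to [k], so there
    are at least [k.+1] of them. *)
Lemma rbp_chain_lower ms : rbp_pebbling (G := chain k) 3 ms -> k < rbp_cost ms.
Proof.
rewrite /rbp_pebbling; case run: play => [s|//] final.
apply: leq_trans (rbp_cost_loads ms); rewrite -(size_iota 0 k.+1).
rewrite -(size_map (fun v : chain k => v %/ 4) (pmap _ _)).
apply: uniq_leq_size (iota_uniq 0 k.+1) _ => q; rewrite mem_iota add0n ltnS => /andP[_ le_q].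
have dia := chain_diamond le_q.
have /hasP[v v_ms v_q] := rbp_diamond_load dia run (chain_computed run final le_q).
apply/mapP; exists v => //; move: v_q; rewrite inE /= !inE !cnode_eq; lia.
Qed.

(** One load of the source, then a save and a load per diamond. The bound on [C] keeps the next
    diamond uncomputed, as the one-shot rule requires. *)
Lemma rbp_chain_prefix q : q <= k.+1 ->
  exists ms B C,
    [/\ play (rbp_step 3) (rbp_init (chain k)) ms = Some (RbpState B [set cnode (4 * q)] C),
        rbp_cost ms = 2 * q + 1
      & forall v : chain k, v \in C -> v <= 4 * q].
Proof.
elim: q => [|q IHq] lt_q.
  exists [:: RLoad (cnode (4 * 0))], [set v | is_source v], set0; split=> // [|v]; last by rewrite inE.
  by rewrite /= /rbp_step /= inE chain_source cnodeK // eqxx setU0 cards1.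
have [ms [B [C [run cost leC]]]] := IHq (ltnW lt_q).
have dia := chain_diamond (lt_q : q <= k).
exists (ms ++ rbp_diamond_moves (cnode (4 * q)) (cnode (4 * q + 1)) (cnode (4 * q + 2))
          (cnode (4 * q + 3)) (cnode (4 * q + 4))).
have notC x : 4 * q < x <= 4 * q + 4 -> cnode x \notin C.
  by move=> x_range; apply/negP=> /leC; rewrite cnodeK; lia.
do 2!eexists; split.
- rewrite (play_cat _ run) (rbp_diamond_play dia); last by split; apply: notC; lia.
  by have -> : 4 * q + 4 = 4 * q.+1 by lia.
- by rewrite /rbp_cost count_cat -/(rbp_cost ms) cost /=; lia.
move=> v; rewrite in_setU in_seqset !inE !cnode_eq; try lia.
by case/orP=> [/leC|]; lia.
Qed.

Lemma rbp_chain_upper :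
  exists2 ms, rbp_pebbling (G := chain k) 3 ms & rbp_cost ms = 2 * k.+1 + 2.
Proof.
have [ms [B [C [run cost leC]]]] := rbp_chain_prefix (leqnn _).
exists (rcons ms (RSave (cnode (4 * k.+1)))).
  rewrite /rbp_pebbling -cats1 (play_cat _ run) /= /rbp_step /= inE eqxx cards1 /=.
  by apply/forallP=> v; rewrite chain_sink -cnode_eq // !inE; apply/implyP=> ->.
by rewrite /rbp_cost -cats1 count_cat -/(rbp_cost ms) cost /=; lia.
Qed.

(** For [x = 4 * q] these are the edges of the first [q] diamonds, since an edge belongs to the
    diamond that contains its head as a non-top node. *)
Definition chain_edges_upto (x : nat) : {set chain k * chain k} :=
  [set p : chain k * chain k | edge p.1 p.2 && (p.2 <= x)].

Lemma chain_edges_upto0 : chain_edges_upto 0 = set0.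
Proof.
apply/setP=> -[x y]; rewrite !inE /=.
by apply/negP=> /andP[/chain_edge_lt lt_xy]; rewrite leqn0 => /eqP y0; rewrite y0 in lt_xy.
Qed.

Lemma chain_edges_uptoS q : q <= k ->
  chain_edges_upto (4 * q) :|:
    seqset (diamond_edges (cnode (4 * q)) (cnode (4 * q + 1)) (cnode (4 * q + 2))
             (cnode (4 * q + 3)) (cnode (4 * q + 4))) =
  chain_edges_upto (4 * q.+1).
Proof.
move=> le_q; have dia := chain_diamond le_q; have neq := diamond_neqs dia.
apply/setP=> -[x y]; rewrite in_setU in_seqset !inE !xpair_eqE [(x, y).1]/= [(x, y).2]/=.
(* A head outside diamond [q] rules out its six edges; for a head inside, the in-neighbourhoods of
   the diamond list the tails. *)
have off t : 0 < t <= 4 -> ~~ (4 * q < y <= 4 * q.+1) -> (y == cnode (4 * q + t)) = false.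
  by move=> t_range y_range; rewrite cnode_eq; lia.
have [in_range|out_range] := boolP (4 * q < y <= 4 * q.+1); last first.
  by rewrite !off // !andbF !orbF; congr (_ && _); lia.
case/andP: in_range => gt_y le_y; rewrite le_y leqNgt gt_y andbF andbT orFb.
have : 4 * q + 1 = y \/ 4 * q + 2 = y \/ 4 * q + 3 = y \/ 4 * q + 4 = y by lia.
case=> [|[|[]]] /cnode_ord ->.
- by have /setP/(_ x) := diamond_in_c dia; rewrite !inE => ->; rewrite !neq eqxx !andbF !orbF andbT.
- by have /setP/(_ x) := diamond_in_d dia; rewrite !inE => ->; rewrite !neq eqxx !andbF !orbF andbT.
- by have /setP/(_ x) := diamond_in_b dia; rewrite !inE => ->; rewrite !neq eqxx !andbF !orbF !andbT.
- by have /setP/(_ x) := diamond_in_e dia; rewrite !inE => ->; rewrite !neq eqxx !andbF !andbT.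
Qed.

Lemma chain_edges_upto_fresh q : q <= k ->
  all (predC (mem (chain_edges_upto (4 * q))))
    (diamond_edges (cnode (4 * q)) (cnode (4 * q + 1)) (cnode (4 * q + 2))
             (cnode (4 * q + 3)) (cnode (4 * q + 4))).
Proof.
by move=> le_q; rewrite /= !inE /= !cnodeK; lia.
Qed.

(** The only I/O is the initial load, so the blue set never changes, and the pebble on the top is
    light only before the first diamond. *)
Lemma prbp_chain_prefix q : q <= k.+1 ->
  exists2 ms,
    play (prbp_step 3) (prbp_init (chain k)) ms =
      Some (PrbpState [set v | is_source v]
             (if q == 0 then [set cnode (4 * q)] else set0)
             (if q == 0 then set0 else [set cnode (4 * q)])
             (chain_edges_upto (4 * q)))
    & prbp_cost ms = 1.
Proof.
elim: q => [|q IHq] lt_q.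
  exists [:: PLoad (cnode (4 * 0))] => //.
  rewrite /= /prbp_step /= inE chain_source cnodeK // eqxx setU0 cards1 cards0 /=.
  by rewrite muln0 chain_edges_upto0.
have [ms run cost] := IHq (ltnW lt_q).
have dia := chain_diamond (lt_q : q <= k).
exists (ms ++ prbp_diamond_moves (cnode (4 * q)) (cnode (4 * q + 1)) (cnode (4 * q + 2))
          (cnode (4 * q + 3)) (cnode (4 * q + 4))
          (if q == 0 then PDeleteLight (cnode (4 * q)) else PDeleteDark (cnode (4 * q)))).
  rewrite (play_cat _ run) (prbp_diamond_play dia).
  - by rewrite chain_edges_uptoS // mulnS addnC.
  - by split; rewrite inE chain_source cnodeK; lia.
  - exact: chain_edges_upto_fresh.
  - by apply/subsetP=> z; rewrite !inE /= cnodeK ?leqnn ?andbT //; lia.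
by rewrite /prbp_cost count_cat -/(prbp_cost ms) cost /=; case: (q == 0).
Qed.

Lemma prbp_chain_opt : is_OPT_PRBP (chain k) 3 2.
Proof.
split=> [|ms]; last first.
  by apply: (@prbp_cost_ge2 _ _ _ (cnode 0) (cnode (4 * k.+1)));
     rewrite ?chain_source ?chain_sink cnodeK.
have [ms run cost] := prbp_chain_prefix (leqnn k.+1).
exists (rcons ms (PSave (cnode (4 * k.+1)))).
  rewrite /prbp_pebbling -cats1 (play_cat _ run) /= /prbp_step /=.
  rewrite inE eqxx setU0 setDv cards1 cards0 /=; apply/andP; split.
    by apply/forallP=> v; rewrite chain_sink -cnode_eq // !inE; apply/implyP=> ->.
  apply/forallP=> x; apply/forallP=> y; rewrite inE /=; apply/implyP=> -> /=.
  by have := ltn_ord (y : 'I__); lia.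
by rewrite /prbp_cost -cats1 count_cat -/(prbp_cost ms) cost.
Qed.

End ChainCosts.

Theorem proposition4p7 :
  exists (r : nat) (G : nat -> dag) (opt_rbp : nat -> nat),
    [/\ forall i : nat, [/\ max_indegree (G i) = 2, max_outdegree (G i) = 3
                          & (max_indegree (G i)).+1 <= r],
        forall N : nat, exists i : nat, N <= num_nodes (G i),
        forall i : nat, is_OPT_RBP (G i) r (opt_rbp i),
        Theta opt_rbp (fun i => num_nodes (G i))
      & forall i : nat, is_OPT_PRBP (G i) r 2].
Proof.
have opt_ex k : exists n, is_OPT_RBP (chain k) 3 n.
  by have [ms peb _] := rbp_chain_upper k; apply: ex_min_cost peb.
(* The statement asks for a function, so an optimum is chosen for each [k]. *)
pose opt k := proj1_sig (constructive_indefinite_description _ (opt_ex k)).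
have optP k : is_OPT_RBP (chain k) 3 (opt k).
  exact: proj2_sig (constructive_indefinite_description _ (opt_ex k)).
exists 3, chain, opt; split=> //.
- by move=> k; rewrite chain_max_indegree chain_max_outdegree.
- by move=> N; exists N; rewrite chain_num_nodes; lia.
(* With [n = 4k + 5], the optimum lies between [k + 1 >= n / 5] and [2k + 4 <= n], for every [k]. *)
- exists (5%:R^-1)%R, 1%R; split=> //; exists 0 => k _; rewrite chain_num_nodes.
  have [[ms peb cost] le_opt] := optP k.
  have lower := rbp_chain_lower peb.
  have [ms' /le_opt + cost'] := rbp_chain_upper k; rewrite cost' => upper.
  rewrite GRing.mul1r GRing.mulrC Num.Theory.ler_pdivrMr // -GRing.natrM !Num.Theory.ler_nat; lia.
- by move=> k; apply: prbp_chain_opt.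
Qed.
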